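(* (Edge version) There is an algorithm which, given an integer $k\ge 1$, a connected graph $G$ with $n$ vertices and $m$ edges and an edge-coloring $c:E(G)\to\{1,2,\dots,k\}$, determines for each pair of distinct vertices $u,v$ of $G$ whether there is a conflict-free path between $u$ and $v$; its running time is at most $\mathcal{O}(n^3m^2)$. (Vertex version) There is an algorithm which, given an integer $k\ge 1$, a connected graph $G$ with $n$ vertices and $m$ edges and a vertex-coloring $c:V(G)\to\{1,2,\dots,k\}$, determines for each pair of distinct vertices $u,v$ of $G$ whether there is a conflict-free path between $u$ and $v$; its running time is at most $\mathcal{O}(n^4m)$. In particular both problems are solvable in polynomial time.
   Context: All graphs are simple, undirected and finite. Colorings are arbitrary (adjacent edges or vertices may receive the same color). In an edge-colored graph, a path is conflict-free if some color is used on exactly one of its edges. In a vertex-colored graph, a path is conflict-free if some color is used on exactly one of its vertices (endpoints included). *)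

(* Defs.v *)
From mathcomp Require Import all_boot.

Set Implicit Arguments.
Unset Strict Implicit.
Unset Printing Implicit Defensive.

(** * Graphs, paths and conflict-freeness *)

Record sgraph (n : nat) := SGraph {
  adj :> rel 'I_n;
  adj_sym : symmetric adj;
  adj_irr : irreflexive adj
}.

Definition edges n (G : sgraph n) : {set {set 'I_n}} :=
  [set [set x.1; x.2] | x : 'I_n * 'I_n & adj G x.1 x.2].

Definition connected n (G : sgraph n) : Prop :=
  0 < n /\ forall u v : 'I_n, connect (adj G) u v.

(* The path is [u :: p]: its vertices are pairwise distinct. *)
Definition is_path n (G : sgraph n) (u v : 'I_n) (p : seq 'I_n) : Prop :=
  [/\ path (adj G) u p, last u p = v & uniq (u :: p)].

Definition path_edges n (u : 'I_n) (p : seq 'I_n) : seq {set 'I_n} :=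
  pairmap (fun x y => [set x; y]) u p.

(* The vertices of a path are distinct, hence so are its edges, and [count]
   counts each edge (resp. vertex) of the path once. *)
Definition edge_conflict_free n (c : {set 'I_n} -> nat) (u : 'I_n) p : Prop :=
  exists a, count (fun e => c e == a) (path_edges u p) = 1.

Definition vertex_conflict_free n (c : 'I_n -> nat) (u : 'I_n) p : Prop :=
  exists a, count (fun x => c x == a) (u :: p) = 1.

(* [c] is total for convenience; its values outside [edges G] are never used. *)
Definition edge_coloring n (G : sgraph n) k (c : {set 'I_n} -> nat) : Prop :=
  forall e, e \in edges G -> 1 <= c e <= k.

Definition vertex_coloring n k (c : 'I_n -> nat) : Prop :=
  forall v, 1 <= c v <= k.

(** * A random access machine

   Programs work on finitely many unbounded arrays of natural numbers with
   indirect addressing; arrays are named by literals, and a scalar variable is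
   cell 0 of an array. The only arithmetic operations are addition and
   truncated subtraction: without multiplication, running times under the
   uniform and the logarithmic cost measures are polynomially related. *)

Inductive expr :=
  | ECst of nat
  | EGet of nat & expr
  | EAdd of expr & expr
  | ESub of expr & expr.

Inductive cmd :=
  | CSkip
  | CPut of nat & expr & expr      (* CPut A i e is A[i] := e *)
  | CSeq of cmd & cmd
  | CIf of expr & cmd & cmd        (* a nonzero value counts as true *)
  | CWhile of expr & cmd.

Definition state := nat -> nat -> nat.

Definition update (s : state) (A i v : nat) : state :=
  fun B j => if (B == A) && (j == i) then v else s B j.

Fixpoint eval (s : state) (e : expr) : nat :=
  match e with
  | ECst a => a
  | EGet A i => s A (eval s i)
  | EAdd e1 e2 => eval s e1 + eval s e2
  | ESub e1 e2 => eval s e1 - eval s e2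
  end.

(* A cost measure gives the price of handling a value; every node of an
   expression, including the addresses of array accesses, is charged for the
   value it produces. *)
Definition bitlen (a : nat) : nat := (trunc_log 2 a).+1.
Definition uniform_cost (a : nat) : nat := 1.
Definition logarithmic_cost (a : nat) : nat := bitlen a.

Fixpoint ecost (w : nat -> nat) (s : state) (e : expr) : nat :=
  w (eval s e) +
  match e with
  | ECst _ => 0
  | EGet _ i => ecost w s i
  | EAdd e1 e2 | ESub e1 e2 => ecost w s e1 + ecost w s e2
  end.

(* [exec w P s t s']: started in state [s], the program [P] halts in state [s']
   after running for time [t], as measured by [w]. *)
Inductive exec (w : nat -> nat) : cmd -> state -> nat -> state -> Prop :=
  | exec_skip s : exec w CSkip s 1 s
  | exec_put A i e s :
      exec w (CPut A i e) s (1 + ecost w s i + ecost w s e)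
        (update s A (eval s i) (eval s e))
  | exec_seq P Q s t1 s1 t2 s2 :
      exec w P s t1 s1 -> exec w Q s1 t2 s2 -> exec w (CSeq P Q) s (t1 + t2) s2
  | exec_if e P Q s t s' :
      exec w (if eval s e != 0 then P else Q) s t s' ->
      exec w (CIf e P Q) s (1 + ecost w s e + t) s'
  | exec_while_stop e P s :
      eval s e = 0 -> exec w (CWhile e P) s (1 + ecost w s e) s
  | exec_while_loop e P s t1 s1 t2 s2 :
      eval s e <> 0 -> exec w P s t1 s1 -> exec w (CWhile e P) s1 t2 s2 ->
      exec w (CWhile e P) s (1 + ecost w s e + t1 + t2) s2.

Lemma exec_deterministic w P s t1 s1 t2 s2 :
  exec w P s t1 s1 -> exec w P s t2 s2 -> t1 = t2 /\ s1 = s2.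
Proof.
move=> H1; elim: H1 t2 s2 => {P s t1 s1}
  [s|A i e s|P Q s t1 s1 t2 s2 _ IH1 _ IH2|e P Q s t s' _ IH
  |e P s e0|e P s t1 s1 t2 s2 e1 _ IH1 _ IH2] t3 s3 H3; inversion H3; subst=> //;
  repeat match goal with
  | IH : (forall _ _, exec w ?P ?s _ _ -> _), E : exec w ?P ?s _ _ |- _ =>
      case: (IH _ _ E) => ? ?; subst; clear E
  end; by [].
Qed.

(* The input occupies the arrays 0, 1, 2, ...; all other cells are 0. *)
Definition load (I : seq (seq nat)) : state :=
  fun A i => nth 0 (nth [::] I A) i.

Definition input_size (I : seq (seq nat)) : nat :=
  sumn (map bitlen (flatten I)).

(** * The two problems *)

(* A graph with vertices 0, ..., n-1 is presented by a list of its edges, each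
   occurring once, in arbitrary order and with arbitrary orientation. *)
Definition edge_list n (G : sgraph n) (es : seq ('I_n * 'I_n)) : Prop :=
  perm_eq [seq [set e.1; e.2] | e <- es] (enum (edges G)).

Definition edge_input n (k : nat) (es : seq ('I_n * 'I_n))
    (c : {set 'I_n} -> nat) : seq (seq nat) :=
  [:: [:: n; size es; k]; [seq val e.1 | e <- es]; [seq val e.2 | e <- es];
      [seq c [set e.1; e.2] | e <- es]].

Definition vertex_input n (k : nat) (es : seq ('I_n * 'I_n))
    (c : 'I_n -> nat) : seq (seq nat) :=
  [:: [:: n; size es; k]; [seq val e.1 | e <- es]; [seq val e.2 | e <- es];
      [seq c v | v <- enum 'I_n]].

(* The answer for the pair (u, v) is cell u * n + v of array 4 (nonzero means
   yes). *)
Definition answer n (s : state) (u v : 'I_n) : bool := s 4 (u * n + v) != 0.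

(* [P] solves the problem in time [T n m N], as measured by [w], where [n] and
   [m] are the numbers of vertices and edges and [N] is the bit size of the
   input. *)
Definition edge_algorithm (w : nat -> nat) (P : cmd)
    (T : nat -> nat -> nat -> nat) : Prop :=
  forall n (k : nat) (G : sgraph n) (c : {set 'I_n} -> nat) es,
  1 <= k -> connected G -> edge_coloring G k c -> edge_list G es ->
  exists t s',
  [/\ exec w P (load (edge_input k es c)) t s',
      t <= T n #|edges G| (input_size (edge_input k es c))
    & forall u v : 'I_n, u <> v ->
      answer s' u v <->
      exists p, is_path G u v p /\ edge_conflict_free c u p].

Definition vertex_algorithm (w : nat -> nat) (P : cmd)
    (T : nat -> nat -> nat -> nat) : Prop :=
  forall n (k : nat) (G : sgraph n) (c : 'I_n -> nat) es,
  1 <= k -> connected G -> vertex_coloring k c -> edge_list G es ->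
  exists t s',
  [/\ exec w P (load (vertex_input k es c)) t s',
      t <= T n #|edges G| (input_size (vertex_input k es c))
    & forall u v : 'I_n, u <> v ->
      answer s' u v <->
      exists p, is_path G u v p /\ vertex_conflict_free c u p].

(* Main.v *)
Require Import Defs.
From mathcomp Require Import all_boot zify.

(** A path from [u] to [v] is conflict-free iff it contains some item (an edge or
    a vertex, depending on the version) that is the only one of its color on the
    path. Fix an item [i]. A path through [i] with no other item of that color
    amounts to two disjoint paths leading from [u] and from [v] to [i] after the
    other items of that color are removed. By Menger's theorem for two paths
    ([two_disjoint_paths]) these exist iff no single vertex [z] separates [i] from
    both [u] and [v]. This can be tested without constructing any path: for
    every [i] and [z], search the graph from [i] with [z] deleted, and
    reject the pairs [u], [v] neither of which has been reached; a pair is accepted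
    if it survives all [z] for some [i] ([good], [good_edge], [good_vertex]).

    With [q] items, this makes [q * n] searches, and each is affordable even in the
    crude form of [n] scans of the edge list, in time [n * m]; the pairs add [n ^ 2]
    per search. The total of order [q * n ^ 3 * m] is within both bounds
    ([halts_solver]). The two versions share one program, [solver], in which a flag
    selects where searches start and whose color is compared.

    Correctness and running time are established together by rules for
    [halts P s t Q]: from state [s], the program [P] halts within uniform time [t]
    in a state satisfying [Q]. Cells that a program does not write are tracked
    syntactically ([exec_agree]).

    Logarithmic cost follows from uniform cost for any program: as there is no
    multiplication, a run of uniform time [t] handles only numbers that have
    at most [t] bits more than the input ([exec_logarithmic]), so polynomial
    uniform time is polynomial bit time. *)

Set Implicit Arguments.
Unset Strict Implicit.
Unset Printing Implicit Defensive.

(** * Two disjoint paths *)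

Section TwoPaths.
Variables (T : finType) (e : rel T) (B : {set T}).
Implicit Types (D : {set T}) (u v w z : T).

Definition reaches D w :=
  (w \in D) && [exists b in B, connect [rel x y | e x y && (y \in D)] w b].

Lemma path_within D w p :
  path [rel x y | e x y && (y \in D)] w p = path e w p && all (mem D) p.
Proof.
elim: p w => //= x p IH w; rewrite IH.
by case: (e w x); case: (x \in D); rewrite /= ?andbF.
Qed.

Lemma reachesP D w :
  reflect (exists p, [/\ path e w p, {subset w :: p <= D}, last w p \in B &
                         uniq (w :: p)]) (reaches D w).
Proof.
apply: (iffP andP) => [[wD /exists_inP[b bB /connectP[p wp bE]]]|].
  case/shortenP: wp bE => p' wp' Up' _ bE; exists p'.
  move: wp'; rewrite path_within => /andP[-> /allP pD]; split=> //; last by rewrite -bE.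
  by move=> x /[!inE] /predU1P[->|/pD].
case=> p [wp pD lB _]; split; first by rewrite pD ?mem_head.
apply/exists_inP; exists (last w p) => //; apply/connectP; exists p => //.
by rewrite path_within wp; apply/allP=> x xp; apply: pD; rewrite inE xp orbT.
Qed.

Lemma reachesI D w p : path e w p -> {subset w :: p <= D} -> last w p \in B ->
  reaches D w.
Proof.
move=> wp pD lB; case/shortenP: wp pD lB => q wq Uq qp pD lB.
apply/reachesP; exists q; split=> // x /[!inE] /predU1P[->|/qp xp].
  by rewrite pD ?mem_head.
by rewrite pD // inE xp orbT.
Qed.

Lemma reaches_trans D w p : path e w p -> {subset w :: p <= D} ->
  reaches D (last w p) -> reaches D w.
Proof.
move=> wp pD /reachesP[q [lq qD qB _]]; apply: (@reachesI D w (p ++ q)).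
- by rewrite cat_path wp.
- move=> x; rewrite -cat_cons mem_cat => /orP[/pD //|xq].
  by apply: qD; rewrite inE xq orbT.
by rewrite last_cat.
Qed.

(** Menger's theorem for two paths, by induction on [D]: delete [u] and restart
    from one of its neighbors [u'] other than [v]. This fails only if every such
    [u'] has a vertex [z'] cutting both [u'] and [v] from [B] once [u] is gone.
    All vertices that cut [v] from [B] without [u] lie on one path [P] from [v],
    and the last of them, [z], would cut both [u] and [v] from [B] in [D]: a path
    from [u] that avoids [z] continues with some [u'], hence meets its [z'], which
    [v] reaches along [P] before [z]. *)
Lemma two_disjoint_paths D u v : u != v ->
    (forall z, reaches (D :\ z) u || reaches (D :\ z) v) ->
  exists p q, [/\ path e u p /\ last u p \in B, path e v q /\ last v q \in B,
    uniq ((u :: p) ++ (v :: q)) & {subset (u :: p) ++ (v :: q) <= D}].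
Proof.
have [k] := ubnP #|D|; elim: k => // k IH in D u * => leDk neq_uv sepD.
have notin w : reaches (D :\ w) w = false by rewrite /reaches !inE eqxx.
have uDv : reaches (D :\ v) u by have := sepD v; rewrite notin orbF.
have vDu : reaches (D :\ u) v by have := sepD u; rewrite notin.
have uD : u \in D by case/andP: uDv => /setD1P[].
have [uB|uNB] := boolP (u \in B).
  have [q [vq qD qB Uq]] := reachesP _ _ vDu.
  exists [::], q; split=> //=.
    by move: Uq => /= ->; rewrite andbT; apply/negP=> /qD; rewrite !inE eqxx.
  by move=> x /[!inE] /predU1P[->//|xq]; have /qD/setD1P[] : x \in v :: q by rewrite inE.
have [/existsP[u' /and3P[uu' u'v /forallP sep']]|no_next] := boolP
  [exists u', [&& e u u', u' != v &
     [forall z, reaches (D :\ u :\ z) u' || reaches (D :\ u :\ z) v]]].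
  have [|p [q [[u'p pB] vq Upq pqD]]] := IH (D :\ u) u' _ u'v sep'.
    by rewrite (cardsD1 u) uD in leDk.
  exists (u' :: p), q; split=> //.
  - by rewrite /= uu'.
  - rewrite cat_cons cons_uniq Upq andbT.
    by apply/negP=> /pqD; rewrite !inE eqxx.
  by move=> x; rewrite cat_cons inE => /predU1P[->//|/pqD/setD1P[]].
have cut u' : e u u' -> u' != v ->
    exists2 z, ~~ reaches (D :\ u :\ z) u' & ~~ reaches (D :\ u :\ z) v.
  move=> uu' u'v; have /existsPn/(_ u') := no_next.
  rewrite uu' u'v /= => /forallPn[z]; rewrite negb_or => /andP[]; by exists z.
have [P [vP PD PB UP]] := reachesP _ _ vDu.
pose cutv z := ~~ reaches (D :\ u :\ z) v.
have cutvP z : cutv z -> z \in v :: P.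
  apply: contraR => zP; apply: (reachesI vP) => // x xP.
  by rewrite in_setD1 PD // andbT; apply: contraNneq zP => <-.
have [z0 cut0] : exists z0, cutv z0.
  have [[|u' p] [/= up pD pB Up]] := reachesP _ _ uDv; first by rewrite pB in uNB.
  have [||z _ cutz] := cut u'; [by case/andP: up | | by exists z].
  by have /pD/setD1P[] : u' \in [:: u, u' & p] by rewrite !inE eqxx orbT.
(* [z] is the cut vertex closest to [B] on [P]. *)
have [z cutz zmax] := @arg_maxnP _ z0 cutv (fun z => index z (v :: P)) cut0.
(* Along [P], every other cut vertex [z'] is met before [z]. *)
have vz z' : cutv z' -> z' != z -> reaches (D :\ u :\ z) z' -> reaches (D :\ u :\ z) v.
  move=> cutz' z'z; have := cutvP _ cutz'; move/zmax: cutz'.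
  move=> /[swap] z'P; case/splitPl: z'P vP UP PD zmax => p1 p2 z'E.
  rewrite cat_path -cat_cons => /andP[vp1 _] UP PD _.
  have Up1 : uniq (v :: p1) by move: UP; rewrite cat_uniq => /andP[].
  have z'p1 : z' \in v :: p1 by rewrite -z'E mem_last.
  rewrite [index z' _]index_cat z'p1 -[in index z' (v :: p1)]z'E index_last // => le_z.
  move=> reach_z'; apply: (reaches_trans vp1); rewrite ?z'E // => x xp1.
  rewrite in_setD1 PD ?mem_cat ?xp1 // andbT.
  apply: contra_neq z'z => xz; rewrite -{}xz in le_z *.
  move: le_z; rewrite index_cat xp1 => le_x.
  have: index x (v :: p1) = size p1.
    apply/eqP; rewrite eqn_leq andbC; apply/andP; split=> //.
    by rewrite -ltnS -[X in _ < X]/(size (v :: p1)) index_mem.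
  by move/(congr1 (nth v (v :: p1))); rewrite nth_index // nth_last /= z'E.
(* If it is [v] that reaches [B] off [z], it must do so through [u]. *)
have zu : reaches (D :\ z) u.
  case/orP: (sepD z) => // /reachesP[q [vq qD qB _]].
  have [/splitPl uq|uq] := boolP (u \in v :: q); last first.
    case/negP: cutz; apply: (reachesI vq) => // x xq.
    move: (qD _ xq); rewrite !inE => /andP[-> ->] /=.
    by rewrite andbT; apply: contraNneq uq => <-.
  case: uq vq qD qB => q1 q2 uE; rewrite cat_path uE last_cat uE => /andP[_ uq2] qD q2B.
  apply: (reachesI uq2) => // x /[!inE] /predU1P[->|xq2].
    by rewrite -in_setD1 qD // -cat_cons mem_cat -uE mem_last.
  by rewrite -in_setD1 qD // -cat_cons mem_cat xq2 orbT.
have [[|u' p] [/= up pD pB Up]] := reachesP _ _ zu.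
  by rewrite pB in uNB.
case/andP: Up => u_p Up.
have u'pD : {subset u' :: p <= D :\ u :\ z}.
  move=> x xp; have : x \in u :: u' :: p by rewrite inE xp orbT.
  move/pD; rewrite !inE => /andP[-> ->]; rewrite andbT /=.
  by apply: contraNneq u_p => <-.
have [uu' u'p] := andP up.
have [u'v|u'v] := eqVneq u' v.
  by case/negP: cutz; rewrite -u'v; apply: (reachesI u'p).
have [z' cutz' cutvz'] := cut u' uu' u'v.
have z'p : z' \in u' :: p.
  apply: contraR cutz' => z'p; apply: (reachesI u'p) => // x xp.
  have := u'pD x xp; rewrite !inE => /and3P[_ -> ->]; rewrite !andbT.
  by apply: contraNneq z'p => <-.
case/negP: cutz; apply: (vz z') => //.
  by have := u'pD _ z'p; rewrite !inE => /andP[].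
case/splitPl: z'p u'p u'pD pB => p1 p2 z'E; rewrite cat_path last_cat z'E.
move=> /andP[_ z'p2] u'pD p2B; apply: (reachesI z'p2) => // x.
rewrite [x \in _ :: _]inE => /predU1P[->|xp2].
  by apply: u'pD; rewrite -cat_cons mem_cat -z'E mem_last.
by apply: u'pD; rewrite -cat_cons mem_cat xp2 orbT.
Qed.

End TwoPaths.

(** * From uniform to logarithmic cost *)

Lemma uniform_costE a : uniform_cost a = 1. Proof. by []. Qed.
Lemma logarithmic_costE a : logarithmic_cost a = bitlen a. Proof. by []. Qed.

Lemma bitlen_le v L : v <= 2 ^ L -> bitlen v <= L.+1.
Proof.
by move=> le_vL; rewrite /bitlen ltnS -[leqRHS](@trunc_expnK 2) // leq_trunc_log.
Qed.

Fixpoint econst (e : expr) : nat :=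
  match e with
  | ECst a => a
  | EGet _ i => econst i
  | EAdd e1 e2 | ESub e1 e2 => maxn (econst e1) (econst e2)
  end.

Fixpoint cconst (P : cmd) : nat :=
  match P with
  | CSkip => 0
  | CPut _ i e => maxn (econst i) (econst e)
  | CSeq P Q => maxn (cconst P) (cconst Q)
  | CIf e P Q => maxn (econst e) (maxn (cconst P) (cconst Q))
  | CWhile e P => maxn (econst e) (cconst P)
  end.

Lemma ecost_uniform_gt0 s e : 0 < ecost uniform_cost s e.
Proof. by case: e. Qed.

(** Each node of an expression at most doubles the largest value, so a value has
    at most one bit more per node evaluated. *)
Lemma eval_le L s e : (forall A i, s A i <= 2 ^ L) -> econst e <= 2 ^ L ->
  eval s e <= 2 ^ (L + (ecost uniform_cost s e).-1).
Proof.
move=> sL; elim: e => [a|A i IH|e1 IH1 e2 IH2|e1 IH1 e2 IH2] /=.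
- by rewrite /uniform_cost addn0 /= addn0.
- by move=> _; apply: leq_trans (sL _ _) _; rewrite leq_exp2l // leq_addr.
- rewrite geq_max => /andP[/IH1 {}IH1 /IH2 {}IH2].
  set w1 := ecost _ s e1 in IH1 *; set w2 := ecost _ s e2 in IH2 *.
  have w1p : 0 < w1 := ecost_uniform_gt0 s e1.
  have w2p : 0 < w2 := ecost_uniform_gt0 s e2.
  have l1 : 2 ^ (L + w1.-1) <= 2 ^ (L + (w1 + w2).-1) by rewrite leq_exp2l //; lia.
  have l2 : 2 ^ (L + w2.-1) <= 2 ^ (L + (w1 + w2).-1) by rewrite leq_exp2l //; lia.
  have -> : L + (uniform_cost (eval s e1 + eval s e2) + (w1 + w2)).-1
     = (L + (w1 + w2).-1).+1.
    rewrite /uniform_cost; lia.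
  rewrite expnS mul2n -addnn.
  by apply: leq_add; [exact: leq_trans IH1 l1 | exact: leq_trans IH2 l2].
rewrite geq_max => /andP[/IH1 {}IH1 _].
apply: leq_trans (leq_subr _ _) (leq_trans IH1 _).
by rewrite leq_exp2l // /uniform_cost; lia.
Qed.

Lemma ecost_logarithmic L s e : (forall A i, s A i <= 2 ^ L) ->
    econst e <= 2 ^ L ->
  ecost logarithmic_cost s e <=
    ecost uniform_cost s e * (L + ecost uniform_cost s e).
Proof.
move=> sL; elim: e => [a|A i IH|e1 IH1 e2 IH2|e1 IH1 e2 IH2] /= eL.
- by rewrite !addn0 mul1n addn1 bitlen_le.
- have := IH eL; have := bitlen_le (sL A (eval s i)).
  by rewrite logarithmic_costE !uniform_costE; nia.
- have := eval_le (e := EAdd e1 e2) sL eL => /bitlen_le le_v /=.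
  move: eL; rewrite geq_max => /andP[/IH1 {}IH1 /IH2 {}IH2].
  by rewrite logarithmic_costE !uniform_costE; rewrite /= in le_v; nia.
have := eval_le (e := ESub e1 e2) sL eL => /bitlen_le /=.
move: eL; rewrite geq_max => /andP[/IH1 {}IH1 /IH2 {}IH2].
by rewrite logarithmic_costE !uniform_costE; nia.
Qed.

(** Lacking multiplication, a program lengthens the numbers it handles by at most
    one bit per unit of time, so within time [t] no node costs more than
    [L + t] bits. *)
Lemma exec_logarithmic P s t s' : exec uniform_cost P s t s' ->
  forall L, (forall A i, s A i <= 2 ^ L) -> cconst P <= 2 ^ L ->
  (forall A i, s' A i <= 2 ^ (L + t)) /\
  exists2 t', exec logarithmic_cost P s t' s' & t' <= t * (L + t).
Proof.
have mono L d a : a <= 2 ^ L -> a <= 2 ^ (L + d).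
  by move=> le_a; apply: leq_trans le_a _; rewrite leq_exp2l // leq_addr.
elim=> {P s t s'} [s|A i e s|P Q s t1 s1 t2 s2 _ IH1 _ IH2|e P Q s t s' _ IH
  |e P s e0|e P s t1 s1 t2 s2 e1 _ IH1 _ IH2] L sL /=; rewrite ?geq_max.
- move=> _; split=> [A i|]; first exact: mono.
  by exists 1; [exact: exec_skip | rewrite mul1n addn1].
- move=> /andP[iL eL]; split=> [A' j|].
    rewrite /update; case: ifP => _; last exact: mono.
    apply: leq_trans (eval_le sL eL) _; rewrite leq_exp2l //; lia.
  exists (1 + ecost logarithmic_cost s i + ecost logarithmic_cost s e).
    exact: exec_put.
  have := ecost_logarithmic sL iL; have := ecost_logarithmic sL eL; nia.
- move=> /andP[PL QL]; have [s1L [t1' E1 le1]] := IH1 L sL PL.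
  have [s2L [t2' E2 le2]] := IH2 _ s1L (mono _ t1 _ QL).
  split=> [A i|]; first by rewrite addnA.
  by exists (t1' + t2'); [exact: exec_seq E1 E2 | nia].
- move=> /and3P[eL PL QL]; have [|s1L [t' E1 le1]] := IH L sL; first by case: ifP.
  split=> [A i|]; first by rewrite addnA addnAC mono.
  exists (1 + ecost logarithmic_cost s e + t'); first exact: exec_if E1.
  have := ecost_logarithmic sL eL; nia.
- move=> /andP[eL _]; split=> [A i|]; first exact: mono.
  exists (1 + ecost logarithmic_cost s e); first exact: exec_while_stop.
  have := ecost_logarithmic sL eL; nia.
move=> /andP[eL PL]; have [s1L [t1' E1 le1]] := IH1 L sL PL.
have [|s2L [t2' E2 le2]] := IH2 _ s1L; first by rewrite /= geq_max !mono.
split=> [A i|].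
  have -> : L + (1 + ecost uniform_cost s e + t1 + t2)
    = L + t1 + t2 + (1 + ecost uniform_cost s e) by lia.
  exact: mono.
exists (1 + ecost logarithmic_cost s e + t1' + t2').
  exact: exec_while_loop e1 E1 E2.
have := ecost_logarithmic sL eL; nia.
Qed.

Lemma load_le I A i : load I A i <= 2 ^ input_size I.
Proof.
have lt_bitlen a : a < 2 ^ bitlen a by exact: trunc_log_ltn.
have [le_i|lt_i] := leqP (size (nth [::] I A)) i; first by rewrite /load nth_default.
have [le_A|lt_A] := leqP (size I) A; first by rewrite /load (nth_default _ le_A) nth_nil.
have mem_a : load I A i \in flatten I.
  by apply/flattenP; exists (nth [::] I A); rewrite mem_nth.
apply: leq_trans (ltnW (lt_bitlen _)) _; rewrite leq_exp2l //.
by rewrite /input_size (perm_sumn (perm_map _ (perm_to_rem mem_a))) /= leq_addr.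
Qed.

Lemma input_size_ge_size I : size (flatten I) <= input_size I.
Proof. by rewrite /input_size; elim: (flatten I) => //= a l; rewrite /bitlen; lia. Qed.

Lemma exec_load_logarithmic P I t s' : exec uniform_cost P (load I) t s' ->
  exists2 t', exec logarithmic_cost P (load I) t' s' &
    t' <= t * (input_size I + cconst P + t).
Proof.
move=> E; have [||_ //] := exec_logarithmic E (L := input_size I + cconst P).
  by move=> A i; apply: leq_trans (load_le _ _ _) _; rewrite leq_exp2l // leq_addr.
by apply: leq_trans (ltnW (ltn_expl _ (isT : 1 < 2))) _; rewrite leq_exp2l // leq_addl.
Qed.

(** * Total correctness with time bounds *)

Fixpoint writes (P : cmd) : seq nat :=
  match P with
  | CSkip => [::]
  | CPut A _ _ => [:: A]
  | CSeq P Q | CIf _ P Q => writes P ++ writes Q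
  | CWhile _ P => writes P
  end.

Definition agree (W : seq nat) (s s' : state) : Prop :=
  forall A, A \notin W -> s' A =1 s A.

Lemma agree_trans W s1 s2 s3 : agree W s1 s2 -> agree W s2 s3 -> agree W s1 s3.
Proof. by move=> e12 e23 A AW i; rewrite e23 ?e12. Qed.

Lemma agree_sub W W' s s' : {subset W <= W'} -> agree W s s' -> agree W' s s'.
Proof. by move=> sWW' eW A AW'; apply/eW/(contra _ AW')/sWW'. Qed.

Lemma agree_update W s A i v : A \in W -> agree W s (update s A i v).
Proof. by move=> AW B BW j; rewrite /update; case: eqP BW => //= ->; rewrite AW. Qed.

Lemma exec_agree w P s t s' : exec w P s t s' -> agree (writes P) s s'.
Proof.
have sub W1 W2 : {subset W1 <= W1 ++ W2} by move=> A; rewrite mem_cat => ->.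
have sub' W1 W2 : {subset W2 <= W1 ++ W2}.
  by move=> A; rewrite mem_cat => ->; rewrite orbT.
elim=> {P s t s'} //= [A i e s|P Q s t1 s1 t2 s2 _ IH1 _ IH2|e P Q s t s' _ IH
  |e P s t1 s1 t2 s2 _ _ IH1 _ IH2].
- by apply: agree_update; rewrite mem_head.
- by apply: (@agree_trans _ _ s1); [apply: agree_sub IH1 | apply: agree_sub IH2].
- by case: ifP IH => _; apply: agree_sub.
exact: agree_trans IH1 IH2.
Qed.

Definition halts (P : cmd) (s : state) (t : nat) (Q : state -> Prop) : Prop :=
  exists t' s', [/\ exec uniform_cost P s t' s', t' <= t & Q s'].

Lemma halts_le P s t1 t2 Q : t1 <= t2 -> halts P s t1 Q -> halts P s t2 Q.
Proof. by move=> le12 [t [s' [E le_t Qs']]]; exists t, s'; rewrite (leq_trans le_t). Qed.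

Lemma halts_agree P s t Q : halts P s t Q ->
  halts P s t (fun s' => agree (writes P) s s' /\ Q s').
Proof. by move=> [t' [s' [E le_t Qs']]]; exists t', s'; split=> //; have := exec_agree E. Qed.

Lemma halts_weaken P s t (Q Q' : state -> Prop) :
  (forall s', agree (writes P) s s' -> Q s' -> Q' s') -> halts P s t Q -> halts P s t Q'.
Proof. by move=> QQ' /halts_agree[t' [s' [E le_t [/QQ' /[apply] Qs']]]]; exists t', s'. Qed.

Lemma halts_seq P1 P2 s t1 t2 Q1 Q : halts P1 s t1 Q1 ->
  (forall s', agree (writes P1) s s' -> Q1 s' -> halts P2 s' t2 Q) ->
  halts (CSeq P1 P2) s (t1 + t2) Q.
Proof.
move=> /halts_agree[t1' [s1 [E1 le1 [/[swap] Q1s1 /[swap] H2]]]].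
case/H2 => // t2' [s2 [E2 le2 Qs2]].
by exists (t1' + t2'), s2; split; [exact: exec_seq E1 E2 | exact: leq_add |].
Qed.

Fixpoint loop_free (P : cmd) : bool :=
  match P with
  | CSkip | CPut _ _ _ => true
  | CSeq P Q | CIf _ P Q => loop_free P && loop_free Q
  | CWhile _ _ => false
  end.

(** Only meaningful on loop-free commands, where it spares building derivations
    of [exec] by hand. *)
Fixpoint run (P : cmd) (s : state) : state :=
  match P with
  | CSkip | CWhile _ _ => s
  | CPut A i e => update s A (eval s i) (eval s e)
  | CSeq P Q => run Q (run P s)
  | CIf e P Q => if eval s e != 0 then run P s else run Q s
  end.

Fixpoint esize (e : expr) : nat :=
  match e with
  | ECst _ => 1
  | EGet _ i => (esize i).+1
  | EAdd e1 e2 | ESub e1 e2 => (esize e1 + esize e2).+1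
  end.

Fixpoint run_time (P : cmd) : nat :=
  match P with
  | CSkip | CWhile _ _ => 1
  | CPut A i e => 1 + esize i + esize e
  | CSeq P Q => run_time P + run_time Q
  | CIf e P Q => 1 + esize e + maxn (run_time P) (run_time Q)
  end.

Lemma ecost_uniform s e : ecost uniform_cost s e = esize e.
Proof. by elim: e => //= [A i ->|e1 -> e2 ->|e1 -> e2 ->]. Qed.

Lemma halts_run P s (Q : state -> Prop) : loop_free P -> Q (run P s) ->
  halts P s (run_time P) Q.
Proof.
elim: P s Q => //= [|A i e|P IHP P' IHP'|e P IHP P' IHP'] s Q.
- by exists 1, s; split=> //; apply: exec_skip.
- move=> _ Qs; eexists; eexists; split; [exact: exec_put | | exact: Qs].
  by rewrite !ecost_uniform.
- case/andP=> lP lP' Qs; apply: (halts_seq (Q1 := fun s' => s' = run P s)).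
    exact: IHP.
  by move=> _ _ ->; apply: IHP'.
case/andP=> lP lP' Qs.
have [t [s' [E le_t Qs']]] : halts (if eval s e != 0 then P else P') s
    (maxn (run_time P) (run_time P')) Q.
  by case: ifP Qs => _ Qs; [apply: (@halts_le _ _ (run_time P)); [exact: leq_maxl|exact: IHP]
     | apply: (@halts_le _ _ (run_time P')); [exact: leq_maxr|exact: IHP']].
eexists; exists s'; split; [exact: exec_if E | | by []].
by rewrite ecost_uniform leq_add2l.
Qed.

(** Exceeds the time of every loop-free block of the solver and of the
    bookkeeping of a loop iteration, so that all running times become
    [block_time] times a polynomial. *)
Definition block_time := 100.

Definition var x := EGet x (ECst 0).

(** Loops run up to cell [a] of array 0, that is, up to [n] or [m]. *)
Definition for_ x a P :=
  CSeq (CPut x (ECst 0) (ECst 0))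
    (CWhile (ESub (EGet 0 (ECst a)) (var x))
       (CSeq P (CPut x (ECst 0) (EAdd (var x) (ECst 1))))).

(** [Inv] must not depend on the counter [x]: the body establishes [Inv i.+1] at
    a moment when [x] still holds [i]. *)
Lemma halts_for x a P s T (Inv : nat -> state -> Prop) :
    0 \notin x :: writes P -> x \notin writes P ->
    (forall i s' v, Inv i s' -> Inv i (update s' x 0 v)) ->
    Inv 0 s ->
    (forall i s', i < s 0 a -> agree (x :: writes P) s s' -> s' x 0 = i ->
       Inv i s' -> halts P s' (block_time * T) (Inv i.+1)) ->
  halts (for_ x a P) s (block_time * (1 + s 0 a * (1 + T))) (Inv (s 0 a)).
Proof.
move=> W0 xP Inv_x Inv0 body; set N := s 0 a.
(* The 10 pays for the failing test that leaves the loop. *)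
have loop d i s' : i + d = N -> agree (x :: writes P) s s' -> s' x 0 = i ->
    Inv i s' ->
  halts (CWhile (ESub (EGet 0 (ECst a)) (var x))
     (CSeq P (CPut x (ECst 0) (EAdd (var x) (ECst 1)))))
    s' (10 + d * (block_time + block_time * T)) (Inv N).
  elim: d i s' => [|d IH] i s' iN ag xi Ii.
    eexists; exists s'; split.
    - by apply: exec_while_stop; rewrite /= xi ag // -/N; lia.
    - by rewrite ecost_uniform.
    by rewrite -iN addn0.
  have [|t1 [s1 [E1 le1 [ag1 I1]]]] := halts_agree (body i s' _ ag xi Ii).
    by rewrite -/N; lia.
  have x1 : s1 x 0 = i by rewrite ag1.
  have [||||t2 [s2 [E2 le2 Is2]]] := IH i.+1 (update s1 x 0 i.+1).
  - by rewrite addSnnS.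
  - apply: agree_trans ag (agree_trans _ (agree_update _ _ _ _)); last exact: mem_head.
    by apply: agree_sub ag1 => A AP; rewrite inE AP orbT.
  - by rewrite /update !eqxx.
  - exact: Inv_x.
  eexists; exists s2; split; [apply: exec_while_loop | | exact: Is2].
  - by rewrite /= xi ag // -/N; lia.
  - apply: exec_seq E1 _; apply: exec_put.
  - by rewrite /= x1 addn1; exact: E2.
  rewrite !ecost_uniform /= mulSn; move: le1 le2; rewrite /block_time; nia.
have [||||t [s' [E le_t Is']]] := loop N 0 (update s x 0 0) => //.
- by apply: agree_update; rewrite mem_head.
- by rewrite /update !eqxx.
- exact: Inv_x.
eexists; exists s'; split; [apply: exec_seq E; exact: exec_put | | exact: Is'].
by rewrite !ecost_uniform /= /block_time in le_t *; nia.
Qed.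

(** * The program *)

(** Arrays 0 to 3 hold the input. [MARK] is the characteristic function of the set
    of vertices reached by the current search. In the phase of item [i], cell
    [BAD] of a pair contains [i + 1] once a deleted vertex has separated the item
    from both members of the pair; as [i + 1] exceeds all earlier stamps, [BAD] is
    never cleared. The arrays from [ITEM] on are scalars. *)
Local Notation ANS := 4.
Local Notation MARK := 5.
Local Notation BAD := 6.
Local Notation ITEM := 7.
Local Notation DEL := 8.
Local Notation ROUND := 9.
Local Notation EDGE := 10.
Local Notation ROW := 11.
Local Notation COL := 12.
Local Notation BASE := 13.
Local Notation CELL := 14.

(** With truncated subtraction one of the two summands is always 0. *)
Definition neq e1 e2 := EAdd (ESub e1 e2) (ESub e2 e1).

Lemma eval_neq s e1 e2 : (eval s (neq e1 e2) != 0) = (eval s e1 != eval s e2).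
Proof. by rewrite /=; lia. Qed.

Definition when e P := CIf e P CSkip.

(** [BASE] runs through the multiples of [n], as the machine cannot multiply. *)
Definition pairs P :=
  CSeq (CPut BASE (ECst 0) (ECst 0))
    (for_ ROW 0
       (CSeq (for_ COL 0 P)
             (CPut BASE (ECst 0) (EAdd (var BASE) (EGet 0 (ECst 0)))))).

Lemma pair_index_inj n u v u' v' : v < n -> v' < n ->
  (u * n + v == u' * n + v') = (u == u') && (v == v').
Proof.
move=> vn v'n; apply/eqP/andP => [E|[/eqP-> /eqP->] //].
have uu' : u = u'.
  have := congr1 (divn^~ n) E; rewrite /= !divnMDl ?(leq_ltn_trans _ vn) //.
  by rewrite !divn_small // !addn0.
by move: E; rewrite uu' => /addnI->.
Qed.

(** Each cell of [A] is visited once, so the effect of the double loop is that of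
    its body [f] on every cell. *)
Lemma halts_pairs P A (f : nat -> nat -> nat -> nat) s (n := s 0 0) :
    writes P = [:: A] -> A \notin [:: 0; ROW; COL; BASE] ->
    (forall u v s', u < n -> v < n -> agree [:: A; ROW; COL; BASE] s s' ->
       s' ROW 0 = u -> s' COL 0 = v -> s' BASE 0 = u * n ->
       halts P s' block_time (fun s'' => forall k,
         s'' A k = if k == u * n + v then f u v (s' A k) else s' A k)) ->
  halts (pairs P) s (block_time * (2 + 3 * n + 2 * n ^ 2))
    (fun s' => forall u v, u < n -> v < n ->
       s' A (u * n + v) = f u v (s A (u * n + v))).
Proof.
rewrite !inE !negb_or => wP /and4P[A0 AU AV AB] body.
have nB s' B i v : A != B -> update s' B i v A =1 s' A.
  by move=> AB' j; rewrite /update (negPf AB').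
apply: (halts_le (t1 := block_time + block_time * (1 + n * (1 + (2 + 2 * n))))).
  by rewrite /block_time; lia.
apply: (halts_seq (Q1 := fun s' => s' BASE 0 = 0)) => [|s1 ag1 base1].
  by apply: (@halts_le _ _ 3) => //; exact: halts_run.
have {}n1 : s1 0 0 = n by rewrite ag1.
have A1 : s1 A =1 s A by apply: ag1; rewrite inE.
pose Inv u (s' : state) := s' BASE 0 = u * n /\ forall u' v', v' < n ->
  s' A (u' * n + v') = if u' < u then f u' v' (s A (u' * n + v')) else s A (u' * n + v').
have sub W' : {subset W' <= [:: A; ROW; COL; BASE]} ->
    forall s2 s3, agree [:: A; ROW; COL; BASE] s1 s2 -> agree W' s2 s3 ->
    agree [:: A; ROW; COL; BASE] s1 s3.
  by move=> sW s2 s3 ag12 /(agree_sub sW); apply: agree_trans.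
apply: (@halts_weaken _ _ _ (Inv (s1 0 0))).
  rewrite n1 => s' _ [_ Inv_n] u v un vn; by rewrite Inv_n ?un.
rewrite -n1; apply: halts_for.
- by rewrite /= wP !inE; lia.
- by rewrite /= wP !inE; lia.
- by move=> u s' v [baseu Au]; split=> // u' v' /Au; rewrite nB.
- by split=> // u' v' _; rewrite A1.
rewrite n1 => u s2 un ag2 u2 [base2 Au].
have {}ag2 : agree [:: A; ROW; COL; BASE] s1 s2.
  by apply: agree_sub ag2 => B; rewrite /= wP !inE; lia.
pose Inv' v (s' : state) := forall u' v', v' < n ->
  s' A (u' * n + v') = if (u' < u) || (u' == u) && (v' < v)
    then f u' v' (s A (u' * n + v')) else s A (u' * n + v').
have n2 : s2 0 0 = n by rewrite ag2 ?inE // !negb_or; lia.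
apply: (@halts_le _ _ (block_time * (1 + s2 0 0 * (1 + 1)) + 7)).
  by rewrite n2 /block_time; lia.
apply: (halts_seq (Q1 := Inv' n)).
  rewrite -[in Inv' _]n2; apply: halts_for.
  - by rewrite /= wP !inE; lia.
  - by rewrite wP !inE; lia.
  - by move=> v s' x IH u' v' /IH; rewrite nB.
  - by move=> u' v' /Au; rewrite ltn0 andbF orbF.
  rewrite n2 => v s3 vn ag3 v3 IH3.
  have {}ag3' : agree [:: A; ROW; COL; BASE] s1 s3.
    by apply: sub ag2 ag3 => B; rewrite wP !inE; lia.
  rewrite muln1; apply: halts_weaken (body u v s3 un vn _ _ v3 _).
  - move=> s4 _ A4 u' v' v'n; rewrite A4 pair_index_inj // IH3 //.
    have [->|neq_u] := eqVneq u' u; last first.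
      by rewrite /= ltnNge leq_eqVlt eq_sym; case: ltngtP neq_u.
    by rewrite ltnn /= ltnS; case: (ltngtP v' v) => // ->.
  - apply: agree_trans ag3'; apply: agree_sub ag1 => B; rewrite !inE; lia.
  - by rewrite ag3 ?u2 // wP !inE; lia.
  by rewrite ag3 ?base2 // wP !inE; lia.
move=> s3 ag3 IH3; apply: halts_run => //; split=> /=.
  rewrite /update /= !ag3 ?base2 ?n2 ?mulSn 1?addnC //.
    by rewrite /= wP !inE; lia.
  by rewrite /= wP !inE; lia.
move=> u' v' v'n; by rewrite nB // IH3 // v'n andbT ltnS; case: ltngtP.
Qed.

Section Solver.
(** The items are the edges if [on_edges], the vertices otherwise. In
    either case item number [i] has its color in cell [i] of array 3. *)
Variable on_edges : bool.

(** Moves the mark along an edge, unless the edge (its target, for vertex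
    colorings) has the color of the item, or its target is deleted. *)
Definition relax ea eb :=
  when (EGet MARK ea)
    (when (neq (EGet 3 (if on_edges then var EDGE else eb)) (EGet 3 (var ITEM)))
       (when (neq eb (var DEL)) (CPut MARK eb (ECst 1)))).

Definition scan :=
  for_ EDGE 1
    (CSeq (relax (EGet 1 (var EDGE)) (EGet 2 (var EDGE)))
          (relax (EGet 2 (var EDGE)) (EGet 1 (var EDGE)))).

(** Searches start at both ends of an edge item, but for the deleted vertex. A
    vertex item starts its search even when it is itself the deleted vertex, in
    which case [search] removes its mark in the end: so deleting the item leaves
    as reached all other vertices joined to it. This covers paths that begin or
    end at the item. *)
Definition plant :=
  if on_edges then
    CSeq (CPut MARK (EGet 1 (var ITEM)) (ECst 1))
      (CSeq (CPut MARK (EGet 2 (var ITEM)) (ECst 1))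
            (CPut MARK (var DEL) (ECst 0)))
  else CPut MARK (var ITEM) (ECst 1).

Definition search :=
  CSeq (for_ CELL 0 (CPut MARK (var CELL) (ECst 0)))
    (CSeq plant
       (CSeq (for_ ROUND 0 scan) (CPut MARK (var DEL) (ECst 0)))).

Definition pair_cell := EAdd (var BASE) (var COL).
Definition next_item := EAdd (var ITEM) (ECst 1).

Definition record :=
  pairs (CIf (EAdd (EGet MARK (var ROW)) (EGet MARK (var COL))) CSkip
             (CPut BAD pair_cell next_item)).

(** No stamp exceeds [i + 1], so the difference is nonzero exactly for the pairs
    without the stamp of the phase of [i]. *)
Definition collect :=
  pairs (CIf (ESub next_item (EGet BAD pair_cell)) (CPut ANS pair_cell (ECst 1)) CSkip).

Definition solver :=
  for_ ITEM (if on_edges then 1 else 0)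
    (CSeq (for_ DEL 0 (CSeq search record)) collect).

Variable s0 : state.
Let n := s0 0 0.
Let m := s0 0 1.
Hypothesis valid : forall j, j < m -> s0 1 j < n /\ s0 2 j < n.

Definition joins j : rel nat := fun a b =>
  (a == s0 1 j) && (b == s0 2 j) || (a == s0 2 j) && (b == s0 1 j).

(** The moves allowed while item [i] is processed with vertex [z] deleted. *)
Definition step i z : rel nat := fun a b =>
  (b != z) &&
  has (fun j => joins j a b && (s0 3 (if on_edges then j else b) != s0 3 i)) (iota 0 m).

Definition seed i z w :=
  if on_edges then ((w == s0 1 i) || (w == s0 2 i)) && (w != z) else w == i.

Definition hit i z w := exists x p, [/\ seed i z x, path (step i z) x p & last x p = w].

Definition input s := forall A, A < 4 -> s A =1 s0 A.

Lemma input_agree L s s' : all (leq 4) L -> agree L s s' -> input s -> input s'.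
Proof.
move=> /allP L4 ag inp A A4 i; rewrite ag ?inp //.
by apply/negP=> /L4; rewrite leqNgt A4.
Qed.

Lemma step_lt i z a b : step i z a b -> b < n.
Proof.
case/andP=> _ /hasP[j]; rewrite mem_iota => /valid[] ? ? /andP[] /orP[] /andP[_ /eqP->] //.
Qed.

Lemma path_step_lt i z x p : path (step i z) x p -> {in p, forall w, w < n}.
Proof.
elim: p x => //= y p IH x /andP[/step_lt yn /IH pn] w; rewrite inE.
by case/predU1P=> [->|/pn].
Qed.

Lemma run_relax s ea eb A w : run (relax ea eb) s A w =
  if [&& A == MARK, w == eval s eb, s MARK (eval s ea) != 0,
         s 3 (if on_edges then s EDGE 0 else eval s eb) != s 3 (s ITEM 0)
       & eval s eb != s DEL 0]
  then 1 else s A w.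
Proof.
have run_when e P s' : run (when e P) s' = if eval s' e != 0 then run P s' else s' by [].
rewrite /relax !run_when !eval_neq /=.
have -> : eval s (if on_edges then var EDGE else eb) =
    if on_edges then s EDGE 0 else eval s eb.
  by case: on_edges.
by do 3!(case: (_ != _) => /=; last by rewrite !andbF); rewrite !andbT.
Qed.

Section Item.
Variables i z : nat.

Definition sound (s : state) := forall w, w < n -> s MARK w != 0 -> hit i z w.

Lemma hit_step a b : hit i z a -> step i z a b -> hit i z b.
Proof.
move=> [x [p [sx xp la]]] ab; exists x, (rcons p b); rewrite last_rcons.
by split=> //; rewrite rcons_path xp la.
Qed.

Lemma relax_sound s j ea eb : input s -> s ITEM 0 = i -> s DEL 0 = z ->
    s EDGE 0 = j -> j < m -> joins j (eval s ea) (eval s eb) ->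
  sound s -> sound (run (relax ea eb) s).
Proof.
move=> inp si sz sj jm joinj snd w wn; rewrite run_relax sj si sz !(inp 3) //=.
case: ifP => [/and4P[/eqP wb ma col bz] _|_]; last exact: snd.
rewrite wb; apply: (hit_step (a := eval s ea)).
  apply: snd => //; have [] := valid jm.
  by case/orP: joinj => /andP[/eqP-> _].
by rewrite /step bz; apply/hasP; exists j; rewrite ?mem_iota // joinj.
Qed.

(** Marks set early in a scan are seen later in the same scan, so the outcome is
    only bracketed: the marks stay sound and advance by at least one step. *)
Lemma halts_scan s : input s -> s ITEM 0 = i -> s DEL 0 = z -> sound s ->
  halts scan s (block_time * (1 + m * 2)) (fun s' =>
    [/\ sound s', forall w, s MARK w != 0 -> s' MARK w != 0 &
      forall a b, s MARK a != 0 -> step i z a b -> s' MARK b != 0]).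
Proof.
move=> inp si sz snd.
pose Inv k (s' : state) := [/\ sound s', forall w, s MARK w != 0 -> s' MARK w != 0 &
  forall j a b, j < k -> s MARK a != 0 -> joins j a b -> b != z ->
    s0 3 (if on_edges then j else b) != s0 3 i -> s' MARK b != 0].
apply: (@halts_weaken _ _ _ (Inv (s 0 1))).
  move=> s' _ [snd' mono compl]; split=> // a b ma /andP[bz /hasP[j]].
  rewrite mem_iota add0n => jm /andP[ab col]; apply: compl ab bz col => //.
  by rewrite inp.
rewrite /m -inp //; apply: halts_for => //.
rewrite inp // => j s' jm ag sj [snd' mono compl].
have inp' : input s' by apply: input_agree ag inp.
set r1 := relax _ _; set r2 := relax _ _.
have ag1 : agree [:: MARK] s' (run r1 s').
  by move=> A; rewrite inE => /negPf AM w; rewrite run_relax AM.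
have inp1 : input (run r1 s') by apply: input_agree ag1 inp'.
have s'i : s' ITEM 0 = i by rewrite ag.
have s'z : s' DEL 0 = z by rewrite ag.
apply: (@halts_le _ _ (run_time (CSeq r1 r2))).
  by rewrite /r1 /r2 /relax; case: on_edges.
apply: halts_run => //; change (Inv j.+1 (run r2 (run r1 s'))).
have s1E := run_relax s' (EGet 1 (var EDGE)) (EGet 2 (var EDGE)); rewrite -/r1 in s1E.
have snd1 : sound (run r1 s').
  apply: (relax_sound (j := j)) => //=.
  by rewrite sj (inp' 1) // (inp' 2) // /joins !eqxx.
move: (run r1 s') ag1 inp1 s1E snd1 => s1 ag1 inp1 s1E snd1; split.
- apply: (relax_sound (j := j)) => //; rewrite ?ag1 //=.
  by rewrite !ag1 // sj (inp' 1) // (inp' 2) // /joins !eqxx orbT.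
- by move=> w /mono mw; rewrite run_relax; case: ifP => // _; rewrite s1E; case: ifP.
move=> j' a b; rewrite ltnS leq_eqVlt => /predU1P[->|j'j] ma; last first.
  move=> joinj' bz col; have m'b := compl _ _ _ j'j ma joinj' bz col.
  by rewrite run_relax; case: ifP => // _; rewrite s1E; case: ifP.
have m'a := mono _ ma; rewrite run_relax /= (ag1 1) // (ag1 2) // !(ag1 3) //.
rewrite (ag1 ITEM) // (ag1 DEL) // !(ag1 EDGE) // s'i s'z sj.
rewrite (inp' 1) // (inp' 2) // !(inp' 3) //.
move=> /orP[] /andP[/eqP aE /eqP bE] bz col; rewrite -aE -bE.
  case: ifP => // _; rewrite s1E /= sj s'i s'z (inp' 1) // (inp' 2) // !(inp' 3) //.
  by rewrite -aE -bE eqxx m'a bz col.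
rewrite eqxx bz col !andbT /=; case: ifP => // /negbT; rewrite negbK s1E.
by case: ifP => // _ /eqP m0; rewrite m0 in m'a.
Qed.

Hypothesis seed_lt : forall x, seed i z x -> x < n.

(** A walk without repeated vertices shows that [n] rounds suffice. *)
Lemma hit_short w : hit i z w ->
  exists x p, [/\ seed i z x, path (step i z) x p, last x p = w & size p < n].
Proof.
move=> [x [p [sx xp <-]]]; have [p' xp' Up' _] := shortenP xp.
exists x, p'; split=> //; rewrite -[(size p').+1]/(size (x :: p')) -(size_iota 0 n).
apply: uniq_leq_size => // y; rewrite mem_iota inE.
by case/predU1P=> [->|/(path_step_lt xp')] //; apply: seed_lt.
Qed.

Lemma halts_search s : input s -> s ITEM 0 = i -> s DEL 0 = z ->
  halts search s (block_time * (4 + 4 * n + 2 * n * m))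
    (fun s' => forall w, w < n -> s' MARK w != 0 <-> w <> z /\ hit i z w).
Proof.
move=> inp si sz.
apply: (@halts_le _ _ (block_time * (1 + s 0 0 * (1 + 1)) +
    (block_time + (block_time * (1 + n * (1 + (1 + m * 2))) + 4)))).
  by rewrite inp // -/n /block_time; nia.
apply: (halts_seq (Q1 := fun s' => forall w, w < n -> s' MARK w = 0)).
  rewrite /n -(inp 0) //.
  apply: (halts_for (Inv := fun k s' => forall w, w < k -> s' MARK w = 0)) => //.
  move=> k s' kn ag sk IH; apply: (@halts_le _ _ 4) => //; apply: halts_run => //= w.
  by rewrite ltnS /update /= sk; case: ltngtP => //= wk _; rewrite IH.
move=> s1 ag1 zero1.
have inp1 : input s1 by apply: input_agree ag1 inp.
apply: (halts_seq (Q1 := fun s' => forall w, w < n -> (s' MARK w != 0) = seed i z w)).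
  apply: (@halts_le _ _ (run_time plant)); first by rewrite /plant; case: on_edges.
  apply: halts_run; first by rewrite /plant; case: on_edges.
  move=> w wn; have := zero1 w wn; rewrite /plant /seed.
  have s1i : s1 ITEM 0 = i by rewrite ag1.
  have s1z : s1 DEL 0 = z by rewrite ag1.
  case: on_edges; rewrite /= /update /= s1i ?s1z ?(inp1 1) // ?(inp1 2) // => ->.
    by case: (w == z); case: (w == s0 1 i); case: (w == s0 2 i).
  by case: (w == i).
move=> s2 ag2 seed2.
have inp2 : input s2 by apply: input_agree ag2 inp1; rewrite /plant; case: on_edges.
have ag02 : agree [:: MARK; CELL] s s2.
  apply: agree_trans (agree_sub _ ag1) (agree_sub _ ag2).
    by move=> A; rewrite /= !inE; lia.
  by move=> A; rewrite /plant; case: on_edges; rewrite /= !inE; lia.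
pose Inv t (s' : state) := sound s' /\ forall x p, seed i z x ->
  path (step i z) x p -> size p <= t -> s' MARK (last x p) != 0.
apply: (halts_seq (Q1 := Inv n)).
  rewrite /n -(inp2 0) //; apply: halts_for => //.
  - split=> [w wn|x [|//] sx _ _]; first by rewrite seed2 // => sw; exists w, [::].
    by rewrite seed2 ?seed_lt.
  move=> t s3 _ ag3 _ [snd3 compl3].
  have inp3 : input s3 by apply: input_agree ag3 inp2; case: on_edges.
  have s3i : s3 ITEM 0 = i by rewrite ag3 ?ag02 //; case: on_edges.
  have s3z : s3 DEL 0 = z by rewrite ag3 ?ag02 //; case: on_edges.
  apply: halts_weaken (halts_scan inp3 s3i s3z snd3) => s4 _ [snd4 mono4 compl4].
  split=> // x p; case/lastP: p => [|p y] sx.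
    by move=> _ _ /=; apply: mono4; apply: (compl3 x [::]).
  rewrite rcons_path size_rcons last_rcons => /andP[xp py] le_p.
  by apply: compl4 py; apply: compl3.
move=> s3 ag3 [snd3 compl3]; apply: halts_run => //= w wn.
have -> : s3 DEL 0 = z by rewrite ag3 ?ag02 //; case: on_edges.
rewrite /update /=; have [->|wz] := eqVneq w z; first by split=> // -[].
split=> [/snd3 hw|[_ hw]]; first by split; [exact/eqP|exact: hw].
by have [x [p [sx xp <- /ltnW]]] := hit_short hw; apply: compl3.
Qed.

End Item.

Definition marked i z w := w <> z /\ hit i z w.

Let q := s0 0 (if on_edges then 1 else 0).
Hypothesis seeds_valid : forall i z x, i < q -> seed i z x -> x < n.

Lemma halts_record s i : input s -> s ITEM 0 = i ->
  halts record s (block_time * (2 + 3 * n + 2 * n ^ 2)) (fun s' =>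
    forall u v, u < n -> v < n -> s' BAD (u * n + v) =
      if s MARK u + s MARK v != 0 then s BAD (u * n + v) else i.+1).
Proof.
move=> inp si; rewrite /n -(inp 0) //.
apply: (halts_pairs (f := fun u v old =>
  if s MARK u + s MARK v != 0 then old else i.+1)) => //.
move=> u v s' un vn ag s'u s'v s'b.
apply: (@halts_le _ _ (run_time (CIf (EAdd (EGet MARK (var ROW)) (EGet MARK (var COL)))
  CSkip (CPut BAD pair_cell next_item)))) => //.
apply: halts_run => // k /=; rewrite s'u s'v s'b !(ag MARK) // (ag ITEM) // si addn1.
by case: ifP => // _; rewrite ?if_same // /update; case: eqP.
Qed.

Lemma halts_collect s i : input s -> s ITEM 0 = i ->
  halts collect s (block_time * (2 + 3 * n + 2 * n ^ 2)) (fun s' =>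
    forall u v, u < n -> v < n -> s' ANS (u * n + v) =
      if s BAD (u * n + v) <= i then 1 else s ANS (u * n + v)).
Proof.
move=> inp si; rewrite /n -(inp 0) //.
apply: (halts_pairs (f := fun u v old => if s BAD (u * s 0 0 + v) <= i then 1 else old)) => //.
move=> u v s' un vn ag s'u s'v s'b.
apply: (@halts_le _ _ (run_time (CIf (ESub next_item (EGet BAD pair_cell))
  (CPut ANS pair_cell (ECst 1)) CSkip))) => //.
apply: halts_run => // k /=; rewrite s'v s'b !(ag BAD) // (ag ITEM) // si.
rewrite addn1 subn_eq0 -ltnNge ltnS.
by case: ifP => // _; rewrite ?if_same // /update; case: eqP.
Qed.

(** The criterion the solver evaluates for the pair [u], [v] and the item [i]; by
    Menger's theorem it says that a path from [u] to [v] contains [i] and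
    no other item of the same color. *)
Definition good i u v := forall z, z < n -> marked i z u \/ marked i z v.

Lemma halts_solver s : 0 < n -> input s ->
    (forall k, s ANS k = 0) -> (forall k, s BAD k = 0) ->
  halts solver s (block_time * (30 * (1 + q * n ^ 3 * maxn 1 m))) (fun s' =>
    forall u v, u < n -> v < n ->
      s' ANS (u * n + v) != 0 <-> exists2 i, i < q & good i u v).
Proof.
move=> n_gt0 inp ans0 bad0.
pose T := 2 + 3 * n + 2 * n ^ 2.
pose T1 := 4 + 4 * n + 2 * n * m + T.
apply: (@halts_le _ _ (block_time * (1 + q * (1 + (1 + n * (1 + T1) + T))))).
  rewrite leq_mul2l; apply/orP; right.
  have M_gt0 : 0 < maxn 1 m by rewrite leq_max.
  have le_mM : m <= maxn 1 m by rewrite leq_maxr.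
  move: (maxn 1 m) M_gt0 le_mM => M M_gt0 le_mM.
  have le_T : T <= 7 * n ^ 2 by rewrite /T; nia.
  have le_T1 : T1 <= 17 * (n ^ 2 * M) by rewrite /T1; nia.
  have le_n3 : n ^ 2 <= n ^ 3 * M by rewrite (expnS n 2); nia.
  have le_nT1 : n * T1 <= 17 * (n ^ 3 * M) by rewrite (expnS n 2); nia.
  have : 2 + n + n * T1 + T <= 30 * (n ^ 3 * M) by nia.
  nia.
pose Inv i (s' : state) := forall u v, u < n -> v < n ->
  s' BAD (u * n + v) <= i /\
  (s' ANS (u * n + v) != 0 <-> exists2 i', i' < i & good i' u v).
apply: (@halts_weaken _ _ _ (Inv q)) => [s' _ IH u v un vn|]; first by case: (IH u v un vn).
rewrite /q -(inp 0) //; apply: halts_for => //.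
- by rewrite /search /plant; case: on_edges.
- by rewrite /search /plant; case: on_edges.
- by move=> u v un vn; rewrite ans0 bad0; split=> //; split=> // -[].
rewrite (inp 0) // -/q => i s1 iq ag1 s1i IH1.
have inp1 : input s1 by apply: input_agree ag1 inp; rewrite /search /plant; case: on_edges.
pose Inv' z (s' : state) := forall u v, u < n -> v < n ->
  s' BAD (u * n + v) <= i.+1 /\
  (s' BAD (u * n + v) <= i <-> forall z', z' < z -> marked i z' u \/ marked i z' v).
rewrite mulnDr; apply: (halts_seq (Q1 := Inv' n)).
  rewrite /n -(inp1 0) //; apply: halts_for => //.
  - by rewrite /search /plant; case: on_edges.
  - by rewrite /search /plant; case: on_edges.
  - by move=> u v un vn; have [le_i _] := IH1 u v un vn; split; [exact: leqW | split].
  rewrite (inp1 0) // -/n => z s2 zn ag2 s2z IH2.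
  have inp2 : input s2 by apply: input_agree ag2 inp1; rewrite /search /plant; case: on_edges.
  have s2i : s2 ITEM 0 = i by rewrite ag2 // /search /plant; case: on_edges.
  rewrite mulnDr; apply: halts_seq (halts_search (fun x => seeds_valid iq) inp2 s2i s2z) _.
  move=> s3 ag3 mark3.
  have inp3 : input s3 by apply: input_agree ag3 inp2; rewrite /search /plant; case: on_edges.
  have s3i : s3 ITEM 0 = i by rewrite ag3 // /search /plant; case: on_edges.
  apply: halts_weaken (halts_record inp3 s3i) => s4 _ bad4 u v un vn.
  have -> : s4 BAD (u * n + v) = if (s3 MARK u != 0) || (s3 MARK v != 0)
      then s2 BAD (u * n + v) else i.+1.
    rewrite bad4 // addn_eq0 negb_and (ag3 BAD) //.
    by rewrite /search /plant; case: on_edges.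
  have [mu mv] := (mark3 u un, mark3 v vn); have [le_i IH] := IH2 u v un vn.
  have mz : (s3 MARK u != 0) || (s3 MARK v != 0) <-> marked i z u \/ marked i z v.
    split=> [/orP[/mu|/mv]|[/mu->|/mv->]]; rewrite ?orbT //; [by left | by right].
  case: ifP => [/mz mz'|/negP nmz]; split=> //.
    rewrite IH; split=> [allz z'|allz z' lt_z]; last by apply: allz; apply: leqW.
    by rewrite ltnS leq_eqVlt => /predU1P[->|/allz].
  by rewrite ltnn; split=> // allz; case: nmz; apply/mz/allz.
move=> s2 ag2 IH2.
have inp2 : input s2 by apply: input_agree ag2 inp1; rewrite /search /plant; case: on_edges.
have s2i : s2 ITEM 0 = i by rewrite ag2 // /search /plant; case: on_edges.
apply: halts_weaken (halts_collect inp2 s2i) => s3 ag3 ans3 u v un vn.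
have [le_bad badP] := IH2 u v un vn; split; first by rewrite ag3.
have [_ IH] := IH1 u v un vn.
rewrite ans3 // (ag2 ANS); last by rewrite /search /plant; case: on_edges.
case: ifP => [/badP gd|bad_gt]; split=> //; first by exists i.
  by move/IH=> [i' lt_i gd]; exists i' => //; apply: leqW.
case=> i'; rewrite ltnS leq_eqVlt => /predU1P[->|lt_i] gd; last by apply/IH; exists i'.
by have /badP : forall z', z' < n -> marked i z' u \/ marked i z' v;
  [exact: gd | rewrite bad_gt].
Qed.

End Solver.

(** * The criterion and conflict-free paths *)

Lemma rev_walk (T : eqType) (e : rel T) x p : symmetric e -> path e x p ->
  exists p', [/\ path e (last x p) p', last (last x p) p' = x
               & last x p :: p' = rev (x :: p)].
Proof.
move=> sym_e xp; exists (rev (belast x p)); split.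
- by rewrite rev_path (eq_path (e' := e)).
- by case: p {xp} => //= y p; rewrite rev_cons last_rcons.
by rewrite [x :: p]lastI rev_rcons.
Qed.

Lemma set2_inj (T : finType) (a b x y : T) :
  [set a; b] = [set x; y] -> (a = x /\ b = y) \/ (a = y /\ b = x).
Proof.
move=> E.
have xE : x \in [set a; b] by rewrite E set21.
have yE : y \in [set a; b] by rewrite E set22.
have aE : a \in [set x; y] by rewrite -E set21.
have bE : b \in [set x; y] by rewrite -E set22.
by move: xE yE aE bE; do 4![case/set2P=> ?]; subst; auto.
Qed.

(** In a connected graph with several vertices, every vertex is an end of an edge.
    This bounds [n] when the time or the input size is expressed by the
    number of edges. *)
Lemma size_le_connected n (G : sgraph n) es : connected G -> edge_list G es ->
  n <= maxn 1 (2 * size es).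
Proof.
case=> _ conn Ges; rewrite leq_max; case: (leqP n 1) => //= n_gt1.
rewrite -[leqLHS]size_enum_ord mul2n -addnn -{1}(size_map fst es) -(size_map snd es) -size_cat.
apply: uniq_leq_size => [|u _]; first exact: enum_uniq.
have [v vu] : exists v : 'I_n, v != u.
  have n_gt0 := ltnW n_gt1.
  have [u0|u0] := eqVneq (val u) 0.
    by exists (Ordinal n_gt1); rewrite -val_eqE /= u0.
  by exists (Ordinal n_gt0); rewrite -val_eqE /= eq_sym.
have /connectP[[|w p] /=] := conn u v; first by move=> _ E; rewrite E eqxx in vu.
case/andP=> uw _ _.
have : [set u; w] \in [seq [set e.1; e.2] | e <- es].
  by rewrite (perm_mem Ges) mem_enum; apply/imsetP; exists (u, w); rewrite ?inE.
case/mapP=> e e_es /set2_inj[] [-> _]; rewrite mem_cat.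
  by rewrite map_f.
by rewrite (map_f snd) ?orbT.
Qed.

Section Input.
Variables (n : nat) (G : sgraph n) (es : seq ('I_n * 'I_n)) (s0 : state).
Hypothesis Ges : edge_list G es.
Hypotheses (s0n : s0 0 0 = n) (s0m : s0 0 1 = size es).
Hypothesis s01 : forall j, s0 1 j = nth 0 [seq val e.1 | e <- es] j.
Hypothesis s02 : forall j, s0 2 j = nth 0 [seq val e.2 | e <- es] j.
Implicit Types (u v w x y z : 'I_n).

Lemma mem_edges x y : ([set x; y] \in edges G) = adj G x y.
Proof.
apply/imsetP/idP => [[[a b] /[!inE] /= ab]|xy]; last by exists (x, y); rewrite ?inE.
by case/set2_inj => [] [-> ->] //; rewrite adj_sym.
Qed.

Lemma size_edge_list : #|edges G| = size es.
Proof. by rewrite cardE -(perm_size Ges) size_map. Qed.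

Lemma nth_edge_list j : j < size es ->
  exists2 e, e \in es & forall f : 'I_n * 'I_n -> nat, nth 0 [seq f e | e <- es] j = f e.
Proof.
case E : es => [|e0 es'] //; rewrite -E => jm; exists (nth e0 es j); first exact: mem_nth.
by move=> f; rewrite (nth_map e0).
Qed.

Lemma adj_edge_list e : e \in es -> adj G e.1 e.2.
Proof.
move=> e_es; rewrite -mem_edges -mem_enum -(perm_mem Ges).
exact: (map_f (fun e : 'I_n * 'I_n => [set e.1; e.2])) e_es.
Qed.

Lemma valid_input j : j < s0 0 1 -> s0 1 j < s0 0 0 /\ s0 2 j < s0 0 0.
Proof.
by rewrite s0m s0n s01 s02 => /nth_edge_list[e _ eE]; rewrite !eE; split; apply: ltn_ord.
Qed.

Lemma joins_adj j x y : j < size es -> joins s0 j x y -> adj G x y /\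
  forall f : {set 'I_n} -> nat, nth 0 [seq f [set e.1; e.2] | e <- es] j = f [set x; y].
Proof.
move=> /nth_edge_list[e e_es eE]; rewrite /joins s01 s02 !eE !val_eqE.
have Ge := adj_edge_list e_es.
case/orP=> /andP[/eqP-> /eqP->]; first by split.
by rewrite adj_sym setUC; split.
Qed.

Lemma adj_joins x y : adj G x y -> exists2 j, j < size es & joins s0 j x y.
Proof.
rewrite -mem_edges -mem_enum -(perm_mem Ges) => /mapP[e e_es eE].
exists (index e es); first by rewrite index_mem.
have jE (f : 'I_n * 'I_n -> nat) : nth 0 [seq f e | e <- es] (index e es) = f e.
  by rewrite (nth_map e) ?index_mem // nth_index.
rewrite /joins s01 s02 !jE !val_eqE.
by case: (set2_inj eE) => [] [-> ->]; rewrite !eqxx ?orbT.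
Qed.

Lemma ordinal_seq (p : seq nat) : {in p, forall w : nat, w < n} ->
  exists p' : seq 'I_n, p = map val p'.
Proof.
elim: p => [|w p IH] pn; first by exists [::].
have [|p' ->] := IH; first by move=> y yp; apply: pn; rewrite inE yp orbT.
have wn : w < n by rewrite pn ?mem_head.
by exists (Ordinal wn :: p').
Qed.

(** From searches on numbers to walks in the graph. *)
Lemma markedP on_edges i (z w : 'I_n) :
    (forall x : nat, seed on_edges s0 i z x -> x < n) ->
  marked on_edges s0 i z w <-> w != z /\ exists x p,
    [/\ seed on_edges s0 i z (val x), path (relpre val (step on_edges s0 i z)) x p
      & last x p = w].
Proof.
move=> seed_lt; split=> [[wz [x [p [sx xp lw]]]]|[wz [x [p [sx xp lw]]]]].
  split; first by apply/eqP=> E; apply: wz; rewrite E.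
  have [|p' pE] := @ordinal_seq p.
    by rewrite -s0n; apply: path_step_lt xp; apply: valid_input.
  exists (Ordinal (seed_lt _ sx)), p'; split=> //.
    by rewrite -path_map -pE.
  by apply: val_inj; rewrite -last_map -pE.
split; first by move/val_inj/eqP; rewrite (negPf wz).
by exists (val x), (map val p); rewrite path_map last_map lw.
Qed.

Section Edge.
Variable c : {set 'I_n} -> nat.
Hypothesis s03 : forall j, s0 3 j = nth 0 [seq c [set e.1; e.2] | e <- es] j.

Definition other_edge a : rel 'I_n := fun x y => adj G x y && (c [set x; y] != a).

Lemma other_edge_sym a : symmetric (other_edge a).
Proof. by move=> x y; rewrite /other_edge adj_sym setUC. Qed.

Lemma step_edge i z x y : step true s0 i z x y = (y != z) && other_edge (s0 3 i) x y.
Proof.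
rewrite /step val_eqE; congr (_ && _); apply/hasP/andP => [[j]|[xy col]].
  rewrite mem_iota s0m => jm /andP[/(joins_adj jm)[xy xyE]].
  by rewrite s03 xyE.
have [j jm jxy] := adj_joins xy; exists j; first by rewrite mem_iota s0m.
by have [_ xyE] := joins_adj jm jxy; rewrite jxy s03 xyE.
Qed.

Lemma marked_edge i z w e : i < size es ->
    (forall f : 'I_n * 'I_n -> nat, nth 0 [seq f e | e <- es] i = f e) ->
  marked true s0 i z w <->
  reaches (other_edge (s0 3 i)) [set e.1; e.2] (setT :\ z) w.
Proof.
move=> im eE; have sym := other_edge_sym (s0 3 i).
have seedE x : seed true s0 i z (val x) = (x \in [set e.1; e.2]) && (x != z).
  by rewrite /seed s01 s02 !eE !val_eqE !inE.
rewrite markedP; last first.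
  by move=> x; rewrite /seed s01 s02 !eE => /andP[/orP[] /eqP-> _]; apply: ltn_ord.
have walkE x p : path (relpre val (step true s0 i z)) x p =
    path (other_edge (s0 3 i)) x p && all (mem (setT :\ z)) p.
  rewrite -path_within; apply: eq_path => a b /=.
  by rewrite step_edge !inE andbT andbC.
split=> [[wz [x [p [sx xp <-]]]]|/reachesP[p [wp pD lB _]]].
  move: xp sx; rewrite walkE seedE => /andP[xp /allP pD] /andP[xB xz].
  have [p' [xp' lp' p'E]] := rev_walk sym xp.
  apply: (reachesI xp'); last by rewrite lp'.
  move=> y; rewrite p'E mem_rev inE => /predU1P[->|/pD //].
  by rewrite !inE xz.
split; first by have := pD w (mem_head _ _); rewrite !inE andbT.
have [p' [lp' l' p'E]] := rev_walk sym wp.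
have p'D y : y \in last w p :: p' -> y \in setT :\ z.
  by rewrite p'E mem_rev; apply: pD.
exists (last w p), p'; split=> //.
  by rewrite seedE lB; have := p'D _ (mem_head _ _); rewrite !inE andbT.
by rewrite walkE lp'; apply/allP=> y yp; apply: p'D; rewrite inE yp orbT.
Qed.

Lemma count_other_edges a u p : path (other_edge a) u p ->
  count (fun e => c e == a) (path_edges u p) = 0.
Proof.
rewrite /path_edges; elim: p u => //= y p IH u /andP[/andP[_ /negPf->]].
by move/IH.
Qed.

Lemma unique_edge a u p : path (adj G) u p ->
    count (fun e => c e == a) (path_edges u p) = 1 ->
  exists p1 y p2, [/\ p = p1 ++ y :: p2, c [set last u p1; y] = a,
    adj G (last u p1) y, path (other_edge a) u p1 & path (other_edge a) y p2].
Proof.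
have none y p' : path (adj G) y p' -> count (fun e => c e == a) (path_edges y p') = 0 ->
    path (other_edge a) y p'.
  rewrite /path_edges; elim: p' y => //= x p' IH y /andP[yx xp'] /eqP.
  rewrite addn_eq0 eqb0 => /andP[col /eqP]; rewrite /other_edge yx col; exact: IH.
rewrite /path_edges; elim: p u => //= y p IH u /andP[uy yp].
have [uya [/(none _ _ yp) yp0]|uya] := eqVneq (c [set u; y]) a.
  by exists [::], y, p.
move/(IH _ yp) => [p1 [x [p2 [-> col yx p1P p2P]]]].
by exists (y :: p1), x, p2; split=> //=; rewrite /other_edge uy uya.
Qed.

(** Let [e] be the item and [a] its color. A conflict-free path with unique edge
    [e] splits into two disjoint paths from [u] and [v] to the ends of [e]
    without color [a], and a deleted vertex meets only one of them. Conversely,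
    two such disjoint paths, provided by Menger's theorem, end at the two
    different ends of [e] and are joined by [e]. *)
Lemma good_edge u v : u != v ->
  (exists2 i, i < size es & good true s0 i u v) <->
  exists p, is_path G u v p /\ edge_conflict_free c u p.
Proof.
move=> uv; split=> [[i im gd]|[p [[up lv Up] [a cnt]]]].
  have [e e_es eE] := nth_edge_list im.
  have ai : s0 3 i = c [set e.1; e.2] by rewrite s03 (eE (fun e => c [set e.1; e.2])).
  have [|p [q [[up pB] [vq qB] Upq _]]] :=
      @two_disjoint_paths _ (other_edge (s0 3 i)) [set e.1; e.2] setT u v uv.
    move=> z; apply/orP; have /gd : val z < s0 0 0 by rewrite s0n ltn_ord.
    by case=> /(marked_edge _ _ im eE); [left | right].
  have [q' [vq' lq' q'E]] := rev_walk (other_edge_sym _) vq.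
  move: Upq; rewrite cat_uniq => /and3P[Up dis Uq].
  have neq_l : last u p != last v q.
    apply: contraNneq dis => E; apply/hasP; exists (last v q); first exact: mem_last.
    by rewrite /= -E mem_last.
  have lE : [set last u p; last v q] = [set e.1; e.2].
    move: pB qB neq_l; rewrite !inE.
    by do 2![case/orP=> /eqP->]; rewrite ?eqxx // setUC.
  have sub x y : other_edge (s0 3 i) x y -> adj G x y by case/andP.
  exists (p ++ last v q :: q'); split; first split.
  - rewrite cat_path (sub_path sub up) /= (sub_path sub vq') andbT.
    by rewrite -mem_edges lE mem_edges; apply: adj_edge_list.
  - by rewrite last_cat.
  - rewrite -cat_cons cat_uniq Up q'E rev_uniq Uq andbT /=.
    by apply: contra dis => /hasP[y]; rewrite mem_rev => yq yp; apply/hasP; exists y.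
  exists (s0 3 i); rewrite /path_edges pairmap_cat count_cat /= lE -ai eqxx.
  by rewrite -!/(path_edges _ _) !count_other_edges.
have [p1 [y [p2 [pE col xy up1 yp2]]]] := unique_edge up cnt.
have [i im jxy] := adj_joins xy; have [_ xyE] := joins_adj im jxy.
have [e e_es eE] := nth_edge_list im.
have ai : s0 3 i = a by rewrite s03 xyE.
have eB : [set e.1; e.2] = [set last u p1; y].
  move: jxy; rewrite /joins s01 s02 !eE !val_eqE.
  by case/orP=> /andP[/eqP-> /eqP->] //; rewrite setUC.
exists i => // z; rewrite s0n => zn.
rewrite -[z]/(val (Ordinal zn)); move: (Ordinal zn) => {zn} z.
rewrite !(marked_edge _ _ im eE) ai eB.
have [zp1|zp1] := boolP (z \in u :: p1); [right|left].
  have [q [vq lq qE]] := rev_walk (other_edge_sym a) yp2.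
  have lv' : last y p2 = v by rewrite -lv pE last_cat.
  rewrite -lv'; apply: (reachesI vq); last by rewrite lq !inE eqxx orbT.
  move=> w; rewrite qE mem_rev => wp2; rewrite !inE andbT.
  apply: contraTneq zp1 => <-; move: Up; rewrite pE -cat_cons cat_uniq.
  by case/and3P=> _ /hasPn/(_ _ wp2).
apply: (reachesI up1); last by rewrite !inE eqxx.
by move=> w wp1; rewrite !inE andbT; apply: contraNneq zp1 => <-.
Qed.

End Edge.

Section Vertex.
Variable c : 'I_n -> nat.
Hypothesis s03 : forall x, s0 3 x = c x.

Lemma step_vertex (i z x y : 'I_n) :
  step false s0 i z x y = (y != z) && (adj G x y && (c y != c i)).
Proof.
rewrite /step val_eqE !s03; congr (_ && _); apply/hasP/andP => [[j]|[xy col]].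
  by rewrite mem_iota s0m => jm /andP[/(joins_adj jm)[xy _]].
by have [j jm jxy] := adj_joins xy; exists j; rewrite ?mem_iota ?s0m // jxy.
Qed.

Lemma marked_vertex (i z w : 'I_n) :
  marked false s0 i z w <-> w != z /\ exists p,
    [/\ path (adj G) i p, {in p, forall y, (y != z) && (c y != c i)} & last i p = w].
Proof.
have seedE (x : nat) : seed false s0 i z x = (x == i) by [].
have walkE p : path (relpre val (step false s0 i z)) i p =
    path (adj G) i p && all (mem [set y | (y != z) && (c y != c i)]) p.
  rewrite -path_within; apply: eq_path => a b /=.
  by rewrite step_vertex !inE andbCA.
rewrite markedP; last by move=> x; rewrite seedE => /eqP->; apply: ltn_ord.
split=> [] [wz]; last first.
  move=> [p [ip pD lp]]; split=> //; exists i, p; rewrite walkE ip seedE eqxx /=.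
  by split=> //; apply/allP=> y /pD; rewrite /= inE.
move=> [x [p []]]; rewrite seedE val_eqE => /eqP->; rewrite walkE => /andP[ip /allP pD] lp.
by split=> //; exists p; split=> // y /pD; rewrite /= inE.
Qed.

Lemma count_other_vertices a s : {in s, forall y, c y != a} ->
  count (fun x => c x == a) s = 0.
Proof. by move=> sa; apply/eqP; rewrite -leqn0 leqNgt -has_count -all_predC; apply/allP. Qed.

Lemma unique_vertex a s : count (fun x => c x == a) s = 1 ->
  exists s1 x s2, [/\ s = s1 ++ x :: s2, c x = a & {in s1 ++ s2, forall y, c y != a}].
Proof.
elim: s => //= y s IH; have [ya [/eqP cnt]|ya /IH[s1 [x [s2 [-> xa sa]]]]] := eqVneq (c y) a.
  exists [::], y, s; split=> // x xs.
  by apply: contraL cnt => xa; rewrite -lt0n -has_count; apply/hasP; exists x.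
exists (y :: s1), x, s2; split=> // w; rewrite cat_cons inE.
by case/predU1P=> [->|/sa].
Qed.

(** As for edges when the item [i] is neither [u] nor [v]: the two disjoint
    paths run to neighbors of [i] in the graph without the color of [i]. If [i] is
    [u] or [v], deleting [i] itself shows that the other one is joined to [i]. *)
Lemma good_vertex u v : u != v ->
  (exists2 i, i < n & good false s0 i u v) <->
  exists p, is_path G u v p /\ vertex_conflict_free c u p.
Proof.
have sym : symmetric (adj G) := @adj_sym n G.
have gdP (i : 'I_n) x y : good false s0 i x y -> forall z,
    marked false s0 i z x \/ marked false s0 i z y.
  by move=> gd z; apply: gd; rewrite s0n ltn_ord.
move=> uv; split=> [[i0 im]|[p [[up lv Up] [a cnt]]]].
  rewrite -[i0]/(val (Ordinal im)); move: (Ordinal im) => {i0 im} i /gdP gd.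
  have from_item w : marked false s0 i i w -> exists p,
      [/\ path (adj G) i p, uniq (i :: p), {in p, forall y, c y != c i} & last i p = w].
    case/marked_vertex=> _ [p [ip pD <-]]; case/shortenP: ip => q iq Uq sub.
    by exists q; split=> // y /sub /pD /andP[].
  have [iu|iu] := eqVneq i u.
    subst i; have /from_item[q [uq Uq qc lq]] : marked false s0 u u v.
      by case: (gd u) => // /marked_vertex[]; rewrite eqxx.
    exists q; split; first by split.
    by exists (c u); rewrite /= eqxx count_other_vertices.
  have [iv|iv] := eqVneq i v.
    subst i; have /from_item[q [vq Uq qc lq]] : marked false s0 v v u.
      by case: (gd v) => // /marked_vertex[]; rewrite eqxx.
    have [p [up lp pE]] := rev_walk sym vq; rewrite lq in up lp pE.
    exists p; split; first by split=> //; rewrite pE rev_uniq.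
    by exists (c v); rewrite pE count_rev /= eqxx count_other_vertices.
  pose D := [set y | c y != c i].
  have reach w z : i != w -> marked false s0 i z w ->
      reaches (adj G) [set y | adj G i y] (D :\ z) w.
    move=> iw /marked_vertex[wz [[|b p] [ip pD lw]]]; first by rewrite -lw /= eqxx in iw.
    case/andP: ip => ib bp; have [q [wq lq qE]] := rev_walk sym bp.
    rewrite -lw; apply: (reachesI wq); last by rewrite lq inE.
    by move=> y; rewrite qE mem_rev !inE => /pD.
  have [|p [q [[up pB] [vq qB] Upq pqD]]] :=
      @two_disjoint_paths _ (adj G) [set y | adj G i y] D u v uv.
    by move=> z; apply/orP; case: (gd z) => /reach h; [left | right]; apply: h.
  have [q' [vq' lq' q'E]] := rev_walk sym vq.
  have iN (s : seq 'I_n) : {subset s <= (u :: p) ++ v :: q} -> i \notin s.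
    by move=> sub; apply/negP=> /sub/pqD; rewrite inE eqxx.
  move: (Upq); rewrite cat_uniq => /and3P[Up dis Uq].
  have sub1 : {subset u :: p <= (u :: p) ++ v :: q}.
    by move=> y yp; rewrite mem_cat yp.
  have sub2 : {subset last v q :: q' <= (u :: p) ++ v :: q}.
    by move=> y; rewrite q'E mem_rev mem_cat => ->; rewrite orbT.
  exists (p ++ i :: last v q :: q'); split; first split.
  - rewrite cat_path up /= vq' andbT.
    by rewrite !inE in pB qB; rewrite sym pB qB.
  - by rewrite last_cat.
  - rewrite -cat_cons cat_uniq; apply/and3P; split=> //.
      apply/hasPn=> y; rewrite inE => /predU1P[->|yq]; first exact: iN sub1.
      by move/hasPn: dis; apply; rewrite -mem_rev -q'E.
    by rewrite cons_uniq (iN _ sub2) q'E rev_uniq.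
  have other (s : seq 'I_n) : {subset s <= (u :: p) ++ v :: q} ->
      count (fun x => c x == c i) s = 0.
    by move=> sub; apply: count_other_vertices => y /sub/pqD; rewrite inE.
  exists (c i); rewrite -cat_cons -(cat1s i) !count_cat (other (u :: p)) //.
  by rewrite (other (last v q :: q')) // /= eqxx.
have [s1 [x [s2 [sE xa sa]]]] := unique_vertex cnt.
exists x => // z; rewrite s0n => zn.
rewrite -[z]/(val (Ordinal zn)); move: (Ordinal zn) => {zn} z.
(* The two halves of the path, both directed away from the item [x]. *)
have [xs1 xs2 lu lv'] : [/\ path (adj G) x (rev s1), path (adj G) x s2,
    last x (rev s1) = u & last x s2 = v].
  case: s1 sE sa => [|u' s1] [<- pE] _; first by rewrite -pE.
  move: up lv; rewrite pE cat_path last_cat /= => /and3P[us1 lx xs2] lv'.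
  have up' : path (adj G) u (rcons s1 x) by rewrite rcons_path us1.
  have [q [xq lq qE]] := rev_walk sym up'; move: xq lq qE; rewrite last_rcons.
  by rewrite -rcons_cons rev_rcons => xq lq [qE]; rewrite -qE.
have half s w : path (adj G) x s -> last x s = w -> {subset s <= s1 ++ s2} ->
    w != z -> z \notin s -> marked false s0 x z w.
  move=> xs lw sub wz zs; apply/marked_vertex; split=> //; exists s; split=> // y ys.
  by rewrite xa sa ?sub // andbT; apply: contraNneq zs => <-.
have sub1 : {subset rev s1 <= s1 ++ s2} by move=> y; rewrite mem_rev mem_cat => ->.
have sub2 : {subset s2 <= s1 ++ s2} by move=> y; rewrite mem_cat orbC => ->.
move: Up; rewrite sE uniq_catC cat_cons /= mem_cat negb_or cat_uniq.
move=> /and3P[/andP[xs2' xs1'] _ /andP[/hasPn dis _]].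
have zdis : z \in s1 -> z \notin s2 by move=> /dis.
have last_neq s w : last x s = w -> z != x -> z \notin s -> w != z.
  move=> <- zx zs; apply: contraTneq (mem_last x s) => ->.
  by rewrite inE negb_or zx.
(* Deleting the item leaves both halves intact, and one of them is nontrivial. *)
have [zx|zx] := eqVneq z x.
  have [ux|ux] := eqVneq u x; [right|left].
    by apply: (half _ _ xs2 lv' sub2); rewrite zx // -ux eq_sym.
  by apply: (half _ _ xs1 lu sub1); rewrite zx ?mem_rev.
(* Any other vertex lies on at most one half. *)
have [zs1|zs1] := boolP (z \in s1); [right|left].
  by apply: (half _ _ xs2 lv' sub2); rewrite ?zdis // (last_neq _ _ lv') ?zdis.
by apply: (half _ _ xs1 lu sub1); rewrite ?mem_rev // (last_neq _ _ lu) ?mem_rev.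
Qed.

End Vertex.
End Input.

(** * Conclusion *)

Lemma edge_time_bound n m :
  block_time * (30 * (1 + m * n ^ 3 * maxn 1 m)) <= 60 * block_time * maxn 1 (n ^ 3 * m ^ 2).
Proof.
have -> : m * n ^ 3 * maxn 1 m = n ^ 3 * m ^ 2.
  by case: m => [|m]; rewrite ?muln0 // (maxn_idPr _) // mulnAC mulnn mulnC.
nia.
Qed.

(** Without edges the graph has a single vertex, by the hypothesis, and the time
    is constant. *)
Lemma vertex_time_bound n m : n <= maxn 1 (2 * m) ->
  block_time * (30 * (1 + n * n ^ 3 * maxn 1 m)) <= 60 * block_time * maxn 1 (n ^ 4 * m).
Proof.
rewrite -expnS; case: m => [|m] le_n; last by rewrite (maxn_idPr _) //; nia.
by case: n le_n => [|[|n]] //=; rewrite !muln1 /block_time; lia.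
Qed.

Lemma edge_solver_correct :
  edge_algorithm uniform_cost (solver true)
    (fun n m _ => 60 * block_time * maxn 1 (n ^ 3 * m ^ 2)).
Proof.
move=> n k G c es _ Gconn _ Ges; set I := edge_input k es c.
have vI := @valid_input n es (load I) erefl erefl (fun _ => erefl) (fun _ => erefl).
have [|||||t [s' [E le_t ans]]] := halts_solver vI (on_edges := true) (s := load I) _ _ _ _ _.
- by move=> i z x im /andP[/orP[] /eqP-> _]; have [] := vI _ im.
- by case: Gconn.
- by [].
- by move=> j; rewrite /load /= nth_nil.
- by move=> j; rewrite /load /= nth_nil.
exists t, s'; split=> // [|u v /eqP uv].
  by rewrite (size_edge_list Ges); apply: leq_trans le_t (edge_time_bound _ _).
rewrite -(good_edge (s0 := load I) Ges) //.
by apply: ans; apply: ltn_ord.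
Qed.

Lemma vertex_solver_correct :
  vertex_algorithm uniform_cost (solver false)
    (fun n m _ => 60 * block_time * maxn 1 (n ^ 4 * m)).
Proof.
move=> n k G c es _ Gconn _ Ges; set I := vertex_input k es c.
have vI := @valid_input n es (load I) erefl erefl (fun _ => erefl) (fun _ => erefl).
have [|||||t [s' [E le_t ans]]] := halts_solver vI (on_edges := false) (s := load I) _ _ _ _ _.
- by move=> i z x im /eqP->.
- by case: Gconn.
- by [].
- by move=> j; rewrite /load /= nth_nil.
- by move=> j; rewrite /load /= nth_nil.
exists t, s'; split=> // [|u v /eqP uv].
  rewrite (size_edge_list Ges); apply: leq_trans le_t (vertex_time_bound _).
  exact: size_le_connected Gconn Ges.
rewrite -(good_vertex (s0 := load I) Ges) //; first by apply: ans; apply: ltn_ord.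
by move=> x; rewrite /I /load /= (nth_map x) ?size_enum_ord // nth_ord_enum.
Qed.

Lemma logarithmic_bound C q t N : 0 < N -> t <= C * maxn 1 (N ^ 5) ->
  t * (N + q + t) <= C * (1 + q + C) * N ^ 10.
Proof.
move=> N_gt0; have N5 : 0 < N ^ 5 by rewrite expn_gt0 N_gt0.
have -> : maxn 1 (N ^ 5) = N ^ 5 by lia.
have le_N : N <= N ^ 5 by rewrite -{1}(expn1 N) leq_pexp2l.
rewrite (expnD N 5 5); move: (N ^ 5) N5 le_N => M M_gt0 le_N le_t.
have le_s : N + q + t <= (1 + q + C) * M by nia.
apply: leq_trans (leq_mul le_t le_s) _; lia.
Qed.

(* [maxn 1 _] only matters for the one-vertex graph, where m = 0. *)
Theorem theorem2p5 :
  (exists P : cmd,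
     (exists C : nat,
        edge_algorithm uniform_cost P
          (fun n m _ => C * maxn 1 (n ^ 3 * m ^ 2))) /\
     (exists C d : nat,
        edge_algorithm logarithmic_cost P (fun _ _ N => C * N ^ d))) /\
  (exists P : cmd,
     (exists C : nat,
        vertex_algorithm uniform_cost P
          (fun n m _ => C * maxn 1 (n ^ 4 * m))) /\
     (exists C d : nat,
        vertex_algorithm logarithmic_cost P (fun _ _ N => C * N ^ d))).
Proof.
split.
  exists (solver true); split; first by exists (60 * block_time); apply: edge_solver_correct.
  exists (60 * block_time * (1 + cconst (solver true) + 60 * block_time)), 10.
  move=> n k G c es k_gt0 Gconn Gc Ges.
  have [t [s' [E le_t ans]]] := edge_solver_correct k_gt0 Gconn Gc Ges.
  have [t' E' le_t'] := exec_load_logarithmic E; exists t', s'; split=> //.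
  apply: leq_trans le_t' _.
  have [N_gt0 le_mN le_nN] : [/\ 0 < input_size (edge_input k es c),
      size es <= input_size (edge_input k es c) & n <= input_size (edge_input k es c)].
    have := size_le_connected Gconn Ges; have := input_size_ge_size (edge_input k es c).
    rewrite /= !size_cat !size_map /= => le_N le_n; split; lia.
  apply: logarithmic_bound => //; apply: leq_trans le_t _.
  rewrite leq_mul2l (size_edge_list Ges) geq_max leq_maxl /= leq_max.
  apply/orP; right.
  by rewrite (expnD _ 3 2) leq_mul // ?leq_exp2r.
exists (solver false); split; first by exists (60 * block_time); apply: vertex_solver_correct.
exists (60 * block_time * (1 + cconst (solver false) + 60 * block_time)), 10.
move=> n k G c es k_gt0 Gconn Gc Ges.
have [t [s' [E le_t ans]]] := vertex_solver_correct k_gt0 Gconn Gc Ges.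
have [t' E' le_t'] := exec_load_logarithmic E; exists t', s'; split=> //.
apply: leq_trans le_t' _.
have [N_gt0 le_mN le_nN] : [/\ 0 < input_size (vertex_input k es c),
    size es <= input_size (vertex_input k es c) & n <= input_size (vertex_input k es c)].
  have := input_size_ge_size (vertex_input k es c).
  by rewrite /= !size_cat !size_map -enumT size_enum_ord => /= le_N; split; lia.
apply: logarithmic_bound => //; apply: leq_trans le_t _.
rewrite leq_mul2l (size_edge_list Ges) geq_max leq_maxl /= leq_max.
apply/orP; right.
by rewrite (expnD _ 4 1) leq_mul // ?leq_exp2r.
Qed.
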